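(* Let $d\ge 2$ and $n\geq 7$ be integers and let $U\in \mathrm{SU}(\mathcal{H}_{d})$. Then the $(n-1)$-controlled gate $\mathrm{C}^{n}_{(1,\dots,n-1),n}(U)$ can be synthesized using at most $N_{\mathrm{SU}}(d,n)$ CINC gates, where $$N_{\mathrm{SU}}(d,n)=\begin{cases}16n-48, & \text{if } d=2,\\ 32n-160, & \text{if } d=3,\\ (32d-40)n-192d+272, & \text{if } d\geq 4.\end{cases}$$
   Context: $\mathcal{H}_{d}$ is a $d$-dimensional complex Hilbert space with orthonormal (computational) basis $|0\rangle,\dots,|d-1\rangle$ (a qudit); $\mathrm{U}(\mathcal{H})$ is the group of unitary operators on $\mathcal{H}$, and $\mathrm{SU}(\mathcal{H})$ those of determinant $1$. $X_d=|0\rangle\langle d-1|+\sum_{a=0}^{d-2}|a+1\rangle\langle a|$. For distinct indices $i_1,\dots,i_r,j\in\{1,\dots,n\}$ and $U\in\mathrm{U}(\mathcal{H}_d)$, the gate $\mathrm{C}^{n}_{(i_1,\dots,i_r),j}(U)\in\mathrm{U}(\mathcal{H}_d^{\otimes n})$ acts on a computational basis vector $|x_1\dots x_n\rangle$ by applying $U$ to the $j$-th tensor factor if $x_{i_1}=\dots=x_{i_r}=d-1$, and as the identity otherwise. A CINC gate is any $\mathrm{C}^{n}_{i,j}(X_d)$ with $i\neq j$. A single-qudit gate is an arbitrary unitary acting nontrivially on one tensor factor only. ''Synthesized using at most $N$ CINC gates'' means: equal, as an operator on the given $n$ qudits (no ancilla), to a finite product of CINC gates and single-qudit gates in which at most $N$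 factors are CINC gates (the number of single-qudit gates is not restricted). *)

(* Defs.v *)
From mathcomp Require Import all_boot all_order all_algebra.
From mathcomp Require Import spectral.
From mathcomp Require Import complex.
From mathcomp Require Import reals.

Set Implicit Arguments.
Unset Strict Implicit.
Unset Printing Implicit Defensive.

Import Order.TTheory GRing.Theory Num.Theory.
Local Open Scope ring_scope.

(* Operators are matrices in the computational basis, with kets as columns:
   [A y x] is the matrix element <y|A|x>. *)

(* [x : dits n d] stands for the basis vector |x_1 ... x_n>; the k-th
   tensor factor, 1 <= k <= n, is the ordinal of value k - 1. *)
Definition dits (n d : nat) : finType := {ffun 'I_n -> 'I_d}.

(* Operators on the n-fold tensor power of C^d; the rows and columns are
   numbered through [enum_val : 'I_#|dits n d| -> dits n d]. *)
Notation qop C n d := 'M[C]_#|dits n d|.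

Section Gates.
Variable C : numClosedFieldType.
Variables n d : nat.

(* [ordS] is the cyclic successor, so this sends |d-1> to |0>. *)
Definition X_gate : 'M[C]_d := \sum_(a < d) delta_mx (ordS a) a.

(* id (x) ... (x) U (x) ... (x) id, with U on the j-th tensor factor *)
Definition on_qudit (j : 'I_n) (U : 'M[C]_d) : qop C n d :=
  \matrix_(y, x)
    let y' : dits n d := enum_val y in
    let x' : dits n d := enum_val x in
    if [forall k, (k != j) ==> (y' k == x' k)] then U (y' j) (x' j) else 0.

(* The input basis vector (the column index) decides whether U is applied.
   This is the controlled gate when [j \notin I]. *)
Definition controlled (I : {set 'I_n}) (j : 'I_n) (U : 'M[C]_d) : qop C n d :=
  \matrix_(y, x)
    if [forall i in I, (enum_val x : dits n d) i == d.-1 :> nat]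
    then on_qudit j U y x else 1%:M y x.

Inductive gate : Type :=
  | Single of 'I_n & 'M[C]_d
  | CINC of 'I_n & 'I_n. (* control, target *)

Definition gate_wf (g : gate) : bool :=
  match g with
  | Single _ U => U \is unitarymx
  | CINC i j => i != j
  end.

Definition gate_op (g : gate) : qop C n d :=
  match g with
  | Single j U => on_qudit j U
  | CINC i j => controlled [set i] j X_gate
  end.

Definition is_CINC (g : gate) : bool :=
  if g is CINC _ _ then true else false.

Definition synthesizable (N : nat) (A : qop C n d) : Prop :=
  exists c : seq gate,
    [/\ all gate_wf c, A = \prod_(g <- c) gate_op g & (count is_CINC c <= N)%N].

End Gates.

(* Meant for 2 <= d and 7 <= n, where none of the subtractions truncates. *)
Definition N_SU (d n : nat) : nat :=
  (if d == 2 then 16 * n - 48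
   else if d == 3 then 32 * n - 160
   else (32 * d - 40) * n + 272 - 192 * d)%N.

(* Main.v *)
Require Import Defs.
From mathcomp Require Import all_boot all_order all_algebra.
From mathcomp Require Import spectral.
From mathcomp Require Import zify ring.
From mathcomp Require Import complex.
From mathcomp Require Import reals.

(* Every U in SU(d) is a commutator [P, Q] of two unitary conjugates of X_d:
   diagonalize U and solve two successive multiplicative difference equations
   on the cyclic group. Hence a gate U with two controls takes 4 CINC gates, and
   U controlled by b and s is the commutator of a gate P that is controlled by s
   whenever b is on, and of Q controlled by b alone. Being irrelevant when b is
   off, the former may use b as a clean ancilla; its controls are merged two at
   a time by doubly controlled gates, each merged pair serving in turn as clean
   ancillas on the only branch that matters. For k = n - 2 controls this takes
   8k - 12 CINC gates, so 2(8k - 12) + 2 = 16n - 54 in total for every d, which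
   is at most N_SU d n. *)

Set Implicit Arguments.
Unset Strict Implicit.
Unset Printing Implicit Defensive.

Import GRing.Theory Num.Theory.
Local Open Scope ring_scope.
Local Open Scope complex_scope.

(** * Single-qudit unitaries as commutators of conjugates of [X] *)

Section SingleQudit.
Local Open Scope sesquilinear_scope.
Variables (C : numClosedFieldType) (d : nat).
Implicit Types (U V P Q : 'M[C]_d.+1) (g : 'I_d.+1 -> C).

Local Notation X := (X_gate C d.+1).
Local Notation comm P Q := (P * Q * P^-1 * Q^-1).

Lemma unitarymx_isunit U : U \is unitarymx -> U \is a GRing.unit.
Proof. exact: unitarymx_unit. Qed.

Lemma unitarymxV U : U \is unitarymx -> U^-1 \is unitarymx.
Proof. by move=> uU; rewrite [U^-1]invmx_unitary // trmxC_unitary. Qed.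

Lemma unitarymxM U V :
  U \is unitarymx -> V \is unitarymx -> U * V \is unitarymx.
Proof. exact: mul_unitarymx. Qed.

Lemma invrJ V P : V \is a GRing.unit -> P \is a GRing.unit ->
  (V * P * V^-1)^-1 = V * P^-1 * V^-1.
Proof.
by move=> vV vP; rewrite !invrM ?unitrV ?unitrMl // invrK mulrA.
Qed.

Lemma X_gateE y x : X y x = (y == ordS x)%:R.
Proof.
rewrite summxE (bigD1 x) //= mxE eqxx andbT big1 ?addr0 // => i /negPf nix.
by rewrite mxE [x == i]eq_sym nix andbF.
Qed.

Definition permmx (s : 'I_d.+1 -> 'I_d.+1) : 'M[C]_d.+1 :=
  \matrix_(y, x) (y == s x)%:R.

Lemma permmx_unitary (s : 'I_d.+1 -> 'I_d.+1) :
  injective s -> permmx s \is unitarymx.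
Proof.
move=> sI; apply/unitarymxP/matrixP => y x; rewrite !mxE.
have [t sK tK] := injF_bij sI.
rewrite (bigD1 (t y)) //= !mxE tK eqxx mul1r.
rewrite big1 ?addr0 => [|i niy]; last first.
  by rewrite !mxE -(inj_eq (can_inj tK)) sK eq_sym (negPf niy) mul0r.
by rewrite conjC_nat eq_sym.
Qed.

Lemma X_gate_unitary : X \is unitarymx.
Proof.
have -> : X = permmx (@ordS _).
  by apply/matrixP=> y x; rewrite X_gateE mxE.
exact/permmx_unitary/ordS_inj.
Qed.

Lemma X_gateV : X^-1 = permmx (@ord_pred _).
Proof.
rewrite [X^-1]invmx_unitary ?X_gate_unitary //.
apply/matrixP => y x; rewrite !mxE X_gateE conjC_nat.
by rewrite -(can2_eq (@ordSK _) (@ord_predK _)) eq_sym.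
Qed.

(** The gates whose singly controlled version costs one CINC gate, by [synth_X_like]. *)
Definition X_like P := exists2 V, V \is unitarymx & P = V * X * V^-1.

Lemma X_like_conj V P : V \is unitarymx -> X_like P -> X_like (V * P * V^-1).
Proof.
move=> uV [W uW ->]; exists (V * W); first exact: unitarymxM.
by rewrite invrM ?unitarymx_isunit // !mulrA.
Qed.

Lemma X_like_X : X_like X.
Proof.
exists 1; rewrite ?invr1 ?mulr1 ?mul1r //.
by apply/unitarymxP; rewrite mul1mx trmx1 map_mx1.
Qed.

Lemma X_like_unitary P : X_like P -> P \is unitarymx.
Proof.
by move=> [V uV ->]; rewrite !unitarymxM ?unitarymxV ?X_gate_unitary.
Qed.

(* The reflection a |-> d - 1 - a conjugates the cyclic shift to its inverse. *)
Lemma X_like_V P : X_like P -> X_like P^-1.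
Proof.
pose F := permmx (@rev_ord _).
have uF : F \is unitarymx by apply/permmx_unitary/rev_ord_inj.
suff XV : X^-1 = F * X * F^-1.
  move=> [V uV ->]; rewrite invrJ ?unitarymx_isunit ?X_gate_unitary // XV.
  by do 2!apply: X_like_conj => //; apply: X_like_X.
apply: (can_inj (mulrK (unitarymx_isunit uF))); rewrite mulrVK ?unitarymx_isunit //.
rewrite X_gateV; apply/matrixP=> y x; rewrite !mxE.
rewrite (bigD1 (rev_ord x)) //= big1 ?addr0; last first.
  by move=> i nix; rewrite !mxE (negPf nix) mulr0.
rewrite (bigD1 (ordS x)) //= big1 ?addr0; last first.
  by move=> i nix; rewrite X_gateE (negPf nix) mulr0.
rewrite !mxE X_gateE !eqxx !mulr1; congr (_ == _)%:R; apply/val_inj => /=.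
rewrite subSS; have [->|nxd] := eqVneq (x : nat) d.
  by rewrite subnn modnn subn1 add0n modn_small.
have ltxd : (x < d)%N by rewrite ltn_neqAle nxd -ltnS ltn_ord.
rewrite (@modn_small x.+1 d.+1) // subSS.
have -> : ((d - x + d.+1).-1 = d - x.+1 + d.+1)%N by lia.
by rewrite modnDr modn_small // ltnS leq_subr.
Qed.

(** [r] comes from inverse partial products of [D], and [\prod_a D a = 1] makes it close up around
    the cycle. Its own product is normalized so that the lemma applies again to [r]. *)
Lemma cyclic_quotient (D : 'I_d.+1 -> C) :
  (forall a, `|D a| = 1) -> \prod_a D a = 1 ->
  exists r : 'I_d.+1 -> C, [/\ forall a, `|r a| = 1, \prod_a r a = 1
    & forall a, r (ord_pred a) = D a * r a].
Proof.
move=> D1 pD.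
pose E (m : nat) := \prod_(i < m) (D (inord i.+1))^-1.
have E1 m : `|E m| = 1.
  by rewrite normr_prod big1 // => i _; rewrite normfV D1 invr1.
pose p := \prod_(a < d.+1) E a.
(* [r] is determined up to a constant, which makes [\prod_a r a = 1] possible *)
pose c := d.+1.-root p^-1.
have cE : c ^+ d.+1 = p^-1 by rewrite /c rootCK.
have p1 : `|p| = 1 by rewrite normr_prod big1 // => i _; rewrite E1.
have c1 : `|c| = 1.
  by apply/eqP; rewrite -(@pexpr_eq1 _ _ d.+1) // -normrX cE normfV p1 invr1.
have D0 a : D a != 0 by rewrite -normr_eq0 D1 oner_eq0.
exists (fun a => c * E a); split=> [a||a].
- by rewrite normrM c1 E1 mulr1.
- rewrite big_split /= prodr_const card_ord cE mulVf //.
  by rewrite -normr_eq0 p1 oner_eq0.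
rewrite mulrCA; congr (_ * _); case: a => [[|a] lta] /=; last first.
  rewrite modnDr modn_small; last exact: ltnW.
  rewrite /E big_ord_recr /= [LHS](_ : _ = \prod_(i < a) (D (inord i.+1))^-1) //.
  have -> : Ordinal lta = inord a.+1 by apply/val_inj; rewrite /= inordK.
  by rewrite mulrCA mulfV ?mulr1.
(* Wrap-around at [a = 0]: [E d] is the product of all [(D a)^-1] with [a != 0], that is, [D 0]. *)
rewrite modn_small // {2}/E big_ord0 mulr1.
have := pD; rewrite big_ord_recl.
have -> : Ordinal lta = ord0 by apply/val_inj.
move=> /(canRL (mulfK _)) ->; rewrite ?mul1r.
  rewrite /E prodfV; congr _^-1; apply: eq_bigr => i _; congr D.
  by apply/val_inj; rewrite /= inordK // ltnS.
by apply/prodf_neq0.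
Qed.

Lemma X_diag g :
  X * diag_mx (\row_a g a) = diag_mx (\row_a g (ord_pred a)) * X.
Proof.
apply/matrixP=> y x; rewrite [_ * diag_mx _]mul_mx_diag [_ * X]mul_diag_mx !mxE.
by rewrite mulrC X_gateE; case: eqVneq => [->|]; rewrite ?ordSK // !mulr0.
Qed.

Lemma diag_unitary g : (forall a, `|g a| = 1) ->
  diag_mx (\row_a g a) \is unitarymx.
Proof.
move=> g1; apply/unitarymxP; rewrite tr_diag_mx map_diag_mx mulmx_diag.
apply/matrixP=> i j; rewrite !mxE; case: eqP => // _.
by rewrite -normCK g1 expr1n.
Qed.

(* With [Q := G X G^-1], [G] diagonal of entries [g], the commutator is diagonal
   of entries [g (a-1) ^ 2 / (g (a-2) * g a)]: [cyclic_quotient] used twice. *)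
Lemma diag_comm (D : 'I_d.+1 -> C) : (forall a, `|D a| = 1) ->
  \prod_a D a = 1 -> exists2 Q, X_like Q & diag_mx (\row_a D a) = comm X Q.
Proof.
move=> D1 pD.
have D1' a : `|(D a)^-1| = 1 by rewrite normfV D1 invr1.
have pD' : \prod_a (D a)^-1 = 1 by rewrite prodfV pD invr1.
(* [D] is inverted because the commutator yields the inverse of the second multiplicative difference
   of [g]. *)
have [r [r1 pr rE]] := cyclic_quotient D1' pD'.
have [g [g1 _ gE]] := cyclic_quotient r1 pr.
pose G h := diag_mx (\row_(a < d.+1) (h a : C)) : 'M[C]_d.+1.
pose g' a := g (ord_pred a); pose g'' a := g' (ord_pred a).
have uG : forall h, (forall a, `|h a| = 1) -> G h \is unitarymx by exact: diag_unitary.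
have uGg := unitarymx_isunit (uG _ g1).
have uGg' : G g' \is a GRing.unit by apply/unitarymx_isunit/uG => a; apply: g1.
have uGg'' : G g'' \is a GRing.unit by apply/unitarymx_isunit/uG => a; apply: g1.
have uX := unitarymx_isunit X_gate_unitary.
exists (G g * X * (G g)^-1); first by exists (G g); rewrite ?uG.
have XG : X * G g = G g' * X by exact: X_diag.
have XG' : X * G g' = G g'' * X by exact: X_diag.
have XGV : X * (G g')^-1 = (G g'')^-1 * X.
  by apply: (canLR (mulrK _)) => //; rewrite -mulrA XG' mulKr.
have XGV1 : X * (G g)^-1 = (G g')^-1 * X.
  by apply: (canLR (mulrK _)) => //; rewrite -mulrA XG mulKr.
have -> : comm X (G g * X * (G g)^-1) = G g' * (G g'')^-1 * G g' * (G g)^-1.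
  rewrite invrJ // !mulrA XG -(mulrA _ X X).
  rewrite -(mulrA _ (X * X)) -(mulrA X X) XGV1 (mulrA X) XGV.
  rewrite -!mulrA; do 2!congr (_ * _); rewrite !mulrA mulrK //.
  by rewrite XG mulrK.
have g0 a : g a != 0 by rewrite -normr_eq0 g1 oner_eq0.
have GM h k : G h * G k = G (fun a => h a * k a).
  by rewrite [_ * _]mulmx_diag; congr diag_mx; apply/rowP=> a; rewrite !mxE.
have GV h : (forall a, h a != 0) -> (G h)^-1 = G (fun a => (h a)^-1).
  move=> h0; have hh : G h * G (fun a => (h a)^-1) = 1.
    rewrite GM; apply/matrixP=> i j; rewrite !mxE; case: eqP => // _.
    by rewrite mulfV.
  have [uh _] := mulmx1_unit hh.
  by apply: (mulrI (uh : G h \is a GRing.unit)); rewrite hh mulrV.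
rewrite (GV g'' (fun a => g0 _)) (GV g g0) !GM.
congr diag_mx; apply/rowP=> a; rewrite !mxE.
have r0 b : r b != 0 by rewrite -normr_eq0 r1 oner_eq0.
have D0 b : D b != 0 by rewrite -normr_eq0 D1 oner_eq0.
rewrite /g'' /g' !gE rE.
by field; rewrite ?D0 ?r0 ?g0.
Qed.

(** The eigenvalues of [U] have modulus 1 and product [\det U = 1], so [diag_comm] applies;
    conjugating back preserves commutators and [X_like]. *)
Lemma SU_comm U : U \is unitarymx -> \det U = 1 ->
  exists P Q, [/\ X_like P, X_like Q & U = comm P Q].
Proof.
move=> uU dU.
have nU : U \is normalmx.
  by apply/normalmxP; rewrite (unitarymxP uU) -invmx_unitary // mulVmx ?unitarymx_unit.
have UE := orthomx_spectralP nU.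
set V := spectralmx U in UE; set D := spectral_diag U in UE.
have uV : V \is unitarymx by exact: spectral_unitarymx.
have vV := unitarymx_isunit uV.
have {}UE : U = V^-1 * diag_mx D * V := UE.
have DE : diag_mx D = V * U * V^-1 by rewrite UE !mulrA mulrV // mul1r mulrK.
have uD : diag_mx D \is unitarymx by rewrite DE !unitarymxM ?unitarymxV.
have D1 a : `|D 0 a| = 1.
  have /unitarymxP := uD; rewrite tr_diag_mx map_diag_mx mulmx_diag.
  move=> /matrixP/(_ a a); rewrite !mxE eqxx -normCK => /eqP.
  by rewrite pexpr_eq1 // => /eqP.
have pD : \prod_a D 0 a = 1.
  rewrite -det_diag DE !det_mulmx dU mulr1 -det_mulmx.
  by rewrite -[V *m _]/(V * V^-1) mulrV // det1.
have [Q xQ QE] := diag_comm D1 pD.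
exists (V^-1 * X * V), (V^-1 * Q * V).
have cV P : V^-1 * P * V = V^-1 * P * V^-1^-1 by rewrite invrK.
have xV P : X_like P -> X_like (V^-1 * P * V).
  by rewrite cV; apply: X_like_conj; rewrite unitarymxV.
split; [exact/xV/X_like_X | exact: xV |].
have -> : U = V^-1 * comm X Q * V.
  by rewrite -QE {1}UE; congr (_ * diag_mx _ * _); apply/rowP=> a; rewrite mxE.
have uX := unitarymx_isunit X_gate_unitary.
have vQ := unitarymx_isunit (X_like_unitary xQ).
have vV' : V^-1 \is a GRing.unit by rewrite unitrV.
rewrite !cV !invrJ // invrK !mulrA.
by rewrite !mulrK.
Qed.

(** Meets the determinant condition of [SU_comm] for gates used only in conjugations or commutators,
    where the scalar cancels. *)
Lemma SU_scale U : U \is unitarymx ->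
  exists c, [/\ c != 0, c *: U \is unitarymx & \det (c *: U) = 1].
Proof.
move=> uU; pose c := d.+1.-root (\det U)^-1.
have dU1 : `|\det U| = 1.
  have /(congr1 determinant) := unitarymxP uU.
  rewrite det_mulmx det1 det_map_mx det_tr -normCK => /eqP.
  by rewrite pexpr_eq1 // => /eqP.
have cE : c ^+ d.+1 = (\det U)^-1 by rewrite /c rootCK.
have c1 : `|c| = 1.
  by apply/eqP; rewrite -(@pexpr_eq1 _ _ d.+1) // -normrX cE normfV dU1 invr1.
exists c; split; first by rewrite -normr_eq0 c1 oner_eq0.
  apply/unitarymxP; rewrite linearZ map_mxZ -scalemxAl -scalemxAr scalerA.
  by rewrite (unitarymxP uU) -normCK c1 expr1n scale1r.
by rewrite detZ cE mulVf // -normr_eq0 dU1 oner_eq0.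
Qed.

End SingleQudit.

(** * Block-diagonal operators and generalized controls *)

Section Operators.
Variables (C : numClosedFieldType) (n d : nat).
Local Notation state := (dits n d.+1).
Local Notation M := 'M[C]_d.+1.
Local Notation X := (X_gate C d.+1).
Implicit Types (x y z : state) (f g : state -> bool) (U V P Q W : M).
Implicit Types (i j u v w : 'I_n).

Definition upd x j (a : 'I_d.+1) : state := [ffun k => if k == j then a else x k].

Definition agree j y x := [forall k, (k != j) ==> (y k == x k)].

(* The block-diagonal operator applying [F x] to the j-th qudit of [|x>];
   meaningful when [F] does not depend on that qudit. *)
Definition blk j (F : state -> M) : qop C n d.+1 :=
  \matrix_(y, x) let y' : state := enum_val y in let x' : state := enum_val x in
    if agree j y' x' then F x' (y' j) (x' j) else 0.

(** The control is any predicate on basis states, since conjugation by reversible steps leads beyond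
    conjunctions of qudits. *)
Definition ctl f j U := blk j (fun x => if f x then U else 1).

Definition indep {T} j (F : state -> T) := forall x a, F (upd x j a) = F x.

Lemma upd_eq x j a : upd x j a j = a.
Proof. by rewrite ffunE eqxx. Qed.

Lemma upd_ne x j a i : i != j -> upd x j a i = x i.
Proof. by rewrite ffunE => /negPf ->. Qed.

Lemma updC x i j a b : i != j -> upd (upd x i a) j b = upd (upd x j b) i a.
Proof.
move=> nij; apply/ffunP=> k; rewrite !ffunE.
by have [->|] := eqVneq k j; rewrite // eq_sym (negPf nij).
Qed.

Lemma upd_id x j : upd x j (x j) = x.
Proof. by apply/ffunP=> k; rewrite ffunE; case: eqP => // ->. Qed.

Lemma upd_upd x j a b : upd (upd x j a) j b = upd x j b.
Proof. by apply/ffunP=> k; rewrite !ffunE; case: eqP. Qed.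

Lemma agreeE j y x : agree j y x = (y == upd x j (y j)).
Proof.
apply/forallP/eqP => [yx|-> k]; last by apply/implyP => /upd_ne ->.
apply/ffunP => k; rewrite ffunE; have [->//|nkj] := eqVneq.
by have /implyP/(_ nkj)/eqP := yx k.
Qed.

Lemma agree_upd j y x a : agree j y (upd x j a) = agree j y x.
Proof. by rewrite !agreeE upd_upd. Qed.

Lemma eq_upd j y x a : (y == upd x j a) = agree j y x && (y j == a).
Proof.
rewrite agreeE; apply/eqP/andP => [->|[/eqP yE /eqP <-] //].
by rewrite upd_eq !eqxx.
Qed.

Lemma sum_agree j x (H : state -> C) :
  \sum_z (if agree j z x then H z else 0) = \sum_a H (upd x j a).
Proof.
rewrite -big_mkcond (reindex_onto (upd x j) (fun z => z j)) /=; last first.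
  by move=> z; rewrite agreeE => /eqP <-.
by apply: eq_bigl => a; rewrite agreeE !upd_eq !eqxx.
Qed.

Lemma sum_enum_val (H : state -> C) :
  \sum_(i < #|state|) H (enum_val i) = \sum_x H x.
Proof. by rewrite -big_enum_val. Qed.

Lemma eq_blk j F G : F =1 G -> blk j F = blk j G.
Proof. by move=> FG; apply/matrixP=> y x; rewrite !mxE /= FG. Qed.

Lemma eq_ctl f g j U : f =1 g -> ctl f j U = ctl g j U.
Proof. by move=> fg; apply: eq_blk => x; rewrite fg. Qed.

(** The right factor changes qudit [j] only, so the left one still applies the block [F x]. *)
Lemma blkM j F G : indep j F -> blk j F * blk j G = blk j (fun x => F x * G x).
Proof.
move=> iF; apply/matrixP=> y x; rewrite !mxE.
under eq_bigr do rewrite !mxE.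
move: (enum_val y) (enum_val x) => {}y {}x /=.
rewrite (sum_enum_val (fun z => (if agree j y z then F z (y j) (z j) else 0) *
  if agree j z x then G x (z j) (x j) else 0)).
under eq_bigr => z _ do rewrite (fun_if ( *%R _)) mulr0.
rewrite (sum_agree _ _ (fun z =>
  (if agree j y z then F z (y j) (z j) else 0) * G x (z j) (x j))).
under eq_bigr do rewrite agree_upd upd_eq iF.
by case: ifP => _; rewrite ?mxE // big1 // => a _; rewrite mul0r.
Qed.

Lemma ctl_indep f j U : indep j f -> indep j (fun x => if f x then U else 1).
Proof. by move=> jf x a; rewrite jf. Qed.

Lemma ctlM f j U V : indep j f -> ctl f j U * ctl f j V = ctl f j (U * V).
Proof.
move=> jf; rewrite /ctl blkM; last exact: ctl_indep.
by apply: eq_blk => x; case: ifP; rewrite ?mul1r.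
Qed.

(** When one control is off, the other gate meets its own inverse and the product is 1. *)
Lemma ctl_comm f g j P Q : indep j f -> indep j g ->
  P \is a GRing.unit -> Q \is a GRing.unit ->
  ctl f j P * ctl g j Q * ctl f j P^-1 * ctl g j Q^-1 =
  ctl (fun x => f x && g x) j (P * Q * P^-1 * Q^-1).
Proof.
move=> jf jg uP uQ; have jF := ctl_indep _ jf; have jG := ctl_indep _ jg.
rewrite /ctl !blkM //; try by move=> x a; rewrite ?jf ?jg.
apply: eq_blk => x; case: (f x); case: (g x); rewrite ?mul1r ?mulr1 //=;
by rewrite ?mulrV // mulr1 mulrV.
Qed.

Lemma ctl1 f j : ctl f j 1 = 1.
Proof.
apply/matrixP=> y x; rewrite !mxE /= if_same mxE -(inj_eq enum_val_inj).
move: (enum_val y) (enum_val x) => {}y {}x /=.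
by rewrite -[in RHS](upd_id x j) eq_upd; case: ifP.
Qed.

Lemma controlledE (I : {set 'I_n}) j U :
  controlled I j U = ctl (fun x => [forall i in I, x i == ord_max]) j U.
Proof.
apply/matrixP=> y x; rewrite !mxE -(inj_eq enum_val_inj).
move: (enum_val y) (enum_val x) => {}y {}x /=.
have -> : [forall i in I, x i == ord_max] = [forall i in I, x i == d.+1.-1 :> nat] by [].
case: ifP => // _; rewrite mxE.
by rewrite -{1}(upd_id x j) eq_upd /agree; case: ifP.
Qed.

Lemma on_quditE j U : on_qudit j U = ctl xpredT j U.
Proof. by apply/matrixP=> y x; rewrite !mxE. Qed.

(** * CINC counts for one and two controls *)

Lemma synthM N1 N2 (A B : qop C n d.+1) :
  synthesizable N1 A -> synthesizable N2 B -> synthesizable (N1 + N2) (A * B).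
Proof.
move=> [c1 [w1 -> k1]] [c2 [w2 -> k2]]; exists (c1 ++ c2).
by rewrite all_cat w1 w2 big_cat count_cat leq_add.
Qed.

Lemma synth_leq N1 N2 (A : qop C n d.+1) : (N1 <= N2)%N ->
  synthesizable N1 A -> synthesizable N2 A.
Proof. by move=> le [c [w e k]]; exists c; split=> //; apply: leq_trans le. Qed.

Lemma synth_single j U : U \is unitarymx -> synthesizable 0 (ctl xpredT j U).
Proof.
by move=> uU; exists [:: Single j U]; rewrite /= uU big_seq1 /= on_quditE.
Qed.

Definition on i x := x i == ord_max.

Lemma on_indep i j : i != j -> indep j (on i).
Proof. by move=> ij x a; rewrite /on upd_ne. Qed.

Lemma indepI f g j : indep j f -> indep j g -> indep j (fun x => f x && g x).
Proof. by move=> jf jg x a; rewrite jf jg. Qed.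

Lemma synth_CINC i j : i != j -> synthesizable 1 (ctl (on i) j X).
Proof.
move=> ij; exists [:: CINC C d.+1 i j]; rewrite /= ij big_seq1 /= controlledE; split=> //.
apply: eq_ctl => x; apply/idP/forall_inP => [xi k /set1P -> //|].
by apply; rewrite set11.
Qed.

(** The target of a CINC gate is conjugated by [V]; when the control is off, [V] and [V^-1]
    cancel. *)
Lemma synth_X_like i j P : i != j -> X_like P -> synthesizable 1 (ctl (on i) j P).
Proof.
move=> ij [V uV ->].
have -> : ctl (on i) j (V * X * V^-1) =
    ctl xpredT j V * ctl (on i) j X * ctl xpredT j V^-1.
  have jo := on_indep ij; have uV' := unitarymx_isunit uV.
  rewrite /ctl !blkM //; last by move=> x a; rewrite jo.
  by apply: eq_blk => x; case: ifP; rewrite ?mulr1 ?mulrV.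
apply: (@synthM 1 0); first apply: (@synthM 0 1).
- exact: synth_single.
- exact: synth_CINC.
- exact/synth_single/unitarymxV.
Qed.

Lemma synth_ctl2 u v w U : u != w -> v != w -> U \is unitarymx -> \det U = 1 ->
  synthesizable 4 (ctl (fun x => on u x && on v x) w U).
Proof.
move=> uw vw uU dU; have [P [Q [xP xQ ->]]] := SU_comm uU dU.
have uP := unitarymx_isunit (X_like_unitary xP).
have uQ := unitarymx_isunit (X_like_unitary xQ).
rewrite -ctl_comm //; try exact: on_indep.
have [xP' xQ'] := (X_like_V xP, X_like_V xQ).
rewrite -[4%N]/(1 + 1 + 1 + 1)%N.
by do !apply: synthM; apply: synth_X_like.
Qed.

(** * Conjugation by controlled permutations *)

Definition bmap g w p x := if g x then upd x w (p (x w)) else x.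

(** [bmap] is the action of this gate on basis states up to phase. The scalar [c] is there because a
    permutation matrix may have determinant -1. *)
Lemma ctl_monoE g w c p (y x : 'I_#|state|) :
  ctl g w (c *: permmx C p) y x =
  (if g (enum_val x) then c else 1) * (enum_val y == bmap g w p (enum_val x))%:R.
Proof.
rewrite mxE; move: (enum_val y) (enum_val x) => {}y {}x /=; rewrite /bmap.
case: (g x); last rewrite -[in RHS](upd_id x w).
  by rewrite eq_upd !mxE; case: ifP => //= _; rewrite mulr0.
by rewrite eq_upd !mxE mul1r; case: ifP.
Qed.

Lemma bmap_upd g w p j x a : w != j -> indep j g ->
  bmap g w p (upd x j a) = upd (bmap g w p x) j a.
Proof.
move=> wj jg; rewrite /bmap jg; case: (g x) => //.
by rewrite upd_ne // updC // eq_sym.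
Qed.

Lemma bmap_ne g w p i x : i != w -> bmap g w p x i = x i.
Proof. by rewrite /bmap; case: (g x) => // /upd_ne ->. Qed.

(** The gate on [w] permutes basis states with a phase that does not see qudit [j], so moving it
    across only changes which block of [F] is selected. *)
Lemma blk_bmap j F g w c p : w != j -> indep j g ->
  blk j F * ctl g w (c *: permmx C p) =
  ctl g w (c *: permmx C p) * blk j (fun x => F (bmap g w p x)).
Proof.
move=> wj jg; apply/matrixP=> y x; rewrite !mxE.
under eq_bigr do rewrite ctl_monoE mxE /=.
under [RHS]eq_bigr do rewrite ctl_monoE mxE /=.
move: (enum_val y) (enum_val x) => {}y {}x; set s := bmap g w p.
rewrite (sum_enum_val (fun z => (if agree j y z then F z (y j) (z j) else 0) *
  ((if g x then c else 1) * (z == s x)%:R))).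
rewrite (sum_enum_val (fun z => (if g z then c else 1) * (y == s z)%:R *
  (if agree j z x then F (s x) (z j) (x j) else 0))).
rewrite (bigD1 (s x)) //= eqxx mulr1 big1 ?addr0; last first.
  by move=> z /negPf ->; rewrite !mulr0.
under [RHS]eq_bigr => z _ do rewrite (fun_if ( *%R _)) mulr0.
rewrite (sum_agree _ _ (fun z =>
  (if g z then c else 1) * (y == s z)%:R * F (s x) (z j) (x j))).
under [RHS]eq_bigr do rewrite jg /s bmap_upd // -/s upd_eq eq_upd.
rewrite bmap_ne ?[j == w]eq_sym // -/s; case: ifP => _ /=; last first.
  by rewrite mul0r big1 // => a _; rewrite mulr0 mul0r.
rewrite (bigD1 (y j)) //= eqxx mulr1 mulrC big1 ?addr0 //.
by move=> a /negPf; rewrite eq_sym => ->; rewrite mulr0 mul0r.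
Qed.

(** Conjugation precomposes the control with the permutation, and the phase cancels; [2 * k] pays
    for the gate and its inverse. *)
Lemma synth_bmap N k f j U g w c p : w != j -> indep j g -> indep w g ->
  c *: permmx C p \is unitarymx ->
  synthesizable k (ctl g w (c *: permmx C p)) ->
  synthesizable k (ctl g w (c *: permmx C p)^-1) ->
  synthesizable N (ctl f j U) ->
  synthesizable (N + 2 * k) (ctl (f \o bmap g w p) j U).
Proof.
set W := c *: permmx C p => wj jg wg uW sW sW' sf.
have -> : ctl (f \o bmap g w p) j U = ctl g w W^-1 * ctl f j U * ctl g w W.
  rewrite -mulrA [X in _ * X]blk_bmap // mulrA -/W ctlM //.
  by rewrite mulVr ?unitarymx_isunit // ctl1 mul1r.
rewrite addnC mul2n -addnn addnAC; do 2!apply: synthM => //.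
Qed.

End Operators.

(** * Reversible programs acting on the controls *)

Section Ladder.
Variables (C : numClosedFieldType) (n d : nat).
Hypothesis d_gt0 : (0 < d)%N.
Local Notation state := (dits n d.+1).
Local Notation X := (X_gate C d.+1).
Local Notation all_on s x := (all (fun i => on i x) s).
Implicit Types (x : state) (f : state -> bool) (U : 'M[C]_d.+1).
Implicit Types (i j u v w z : 'I_n) (s : seq 'I_n).

(* [And u v w] turns |0> into |d-1> on [w] when [u] and [v] are both |d-1>. *)
Inductive step := And of 'I_n & 'I_n & 'I_n | Shift of 'I_n.
Implicit Types (p : seq step).

Definition is_And o := if o is And _ _ _ then true else false.

Definition run1 o : state -> state :=
  match o with
  | And u v w => bmap (fun x => on u x && on v x) w (@ord_pred _)
  | Shift w => bmap xpredT w (@ordS _)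
  end.

Definition run p x := foldl (fun y o => run1 o y) x p.

Definition step_in s o :=
  match o with
  | And u v w => [&& u != w, v != w, u \in s, v \in s & w \in s]
  | Shift w => w \in s
  end.

Lemma step_in_sub s1 s2 p : {subset s1 <= s2} ->
  all (step_in s1) p -> all (step_in s2) p.
Proof.
move=> s12; apply: sub_all => -[u v w|w] /=; last exact: s12.
by case/and5P=> -> -> /s12-> /s12-> /s12->.
Qed.

Lemma run1_ne s o i x : step_in s o -> i \notin s -> run1 o x i = x i.
Proof.
by case: o => [u v w /and5P[_ _ _ _ ws] | w ws] nis;
  rewrite bmap_ne //; apply: contraNneq nis => ->.
Qed.

Lemma run_ne s p i x : all (step_in s) p -> i \notin s -> run p x i = x i.
Proof.
move=> + nis; elim: p x => //= o p IHp x /andP[so sp].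
by rewrite IHp // (run1_ne _ so).
Qed.

(** A [Shift] is a single-qudit gate; an [And] costs a doubly controlled gate and its inverse, 4
    CINC gates each. *)
Lemma synth_step N o s f j U : step_in s o -> j \notin s ->
  synthesizable N (ctl f j U) ->
  synthesizable (N + 8 * is_And o) (ctl (f \o run1 o) j U).
Proof.
move=> so js sf; case: o so => [u v w /and5P[uw vw us vs ws]|w ws] /=.
  have nj i : i \in s -> i != j by move=> iis; apply: contraNneq js => <-.
  pose W : 'M[C]_d.+1 := permmx C (@ord_pred _).
  have uW : W \is unitarymx by apply/permmx_unitary/ord_pred_inj.
  have [c [c0 uW' dW']] := SU_scale uW.
  have dW : \det (c *: W)^-1 = 1.
    by rewrite -[_^-1]/(invmx _) det_inv dW' invr1.
  rewrite muln1 -[8%N]/(2 * 4)%N.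
  apply: (@synth_bmap _ _ _ N 4 f j U _ w c); rewrite ?nj //.
  - by apply: indepI; apply: on_indep; rewrite nj.
  - by apply: indepI; apply: on_indep.
  - exact: synth_ctl2.
  - by apply: synth_ctl2; rewrite ?unitarymxV.
have wj : w != j by apply: contraNneq js => <-.
have uW : 1 *: permmx C (@ordS d.+1) \is unitarymx.
  by rewrite scale1r; apply/permmx_unitary/ordS_inj.
rewrite muln0 -[0%N]/(2 * 0)%N.
apply: (@synth_bmap _ _ _ N 0 f j U _ w 1) => //.
  exact: synth_single.
by apply: synth_single; rewrite unitarymxV.
Qed.

(** The first step of [p] is the outermost conjugation. *)
Lemma synth_run N p s f j U : all (step_in s) p -> j \notin s ->
  synthesizable N (ctl f j U) ->
  synthesizable (N + 8 * count is_And p) (ctl (f \o run p) j U).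
Proof.
move=> + js sf; elim: p => [|o p IHp] /=; first by rewrite muln0 addn0.
case/andP=> so /IHp sp; have := synth_step so js sp.
by rewrite -addnA -mulnDr addnC [(_ + is_And o)%N]addnC addnC.
Qed.

Lemma run1_indep s o j x a : step_in s o -> j \notin s ->
  run1 o (upd x j a) = upd (run1 o x) j a.
Proof.
move=> so js; have nj i : i \in s -> i != j.
  by move=> iis; apply: contraNneq js => <-.
case: o so => [u v w /and5P[_ _ us vs ws]|w ws]; apply: bmap_upd => //; try exact: nj.
by apply: indepI; apply: on_indep; apply: nj.
Qed.

Lemma run_indep T s p (f : state -> T) j : all (step_in s) p -> j \notin s ->
  indep j f -> indep j (f \o run p).
Proof.
move=> sp js jf x a /=; rewrite -[RHS](jf _ a); congr f.
elim: p x sp => //= o p IHp x /andP[so sp].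
by rewrite (run1_indep _ _ so) // IHp.
Qed.

(** * Merging controls with clean ancillas *)

Lemma ord_max_neq0 : (ord_max == 0 :> 'I_d.+1) = false.
Proof. by rewrite -val_eqE /= -(prednK d_gt0). Qed.

Lemma ordS_max : ordS ord_max = 0 :> 'I_d.+1.
Proof. by apply/val_inj; rewrite /= modnn. Qed.

Lemma ord_pred0 : ord_pred 0 = ord_max :> 'I_d.+1.
Proof. by apply/val_inj; rewrite /= modn_small. Qed.

(** From 0, [w] either moves to its cyclic predecessor [ord_max] or stays at 0, which counts as off
    because the dimension is at least 2. *)
Lemma run_And u v w x : u != w -> v != w -> x w = 0 ->
  on w (run1 (And u v w) x) = on u x && on v x.
Proof.
move=> uw vw x0; rewrite /on /= /bmap /on; case: ifP => _.
  by rewrite upd_eq x0 ord_pred0 eqxx.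
by rewrite x0 eq_sym ord_max_neq0.
Qed.

(* With a single clean ancilla [z], the conjunction of [s] ends up split over [z]
   and [r]; a second one, [z'], allows merging these two. *)
Definition pair_spec s z := exists p r,
  [/\ all (step_in (z :: s)) p, r \in s, count is_And p = (size s - 2)%N
    & forall x, x z = 0 -> on z (run p x) && on r (run p x) = all_on s x].

Definition single_spec s z z' := exists p r,
  [/\ all (step_in (z :: z' :: s)) p, r \in z' :: s, count is_And p = (size s).-1
    & forall x, x z = 0 -> x z' = 0 -> on r (run p x) = all_on s x].

(* Once [z] holds the conjunction of [x1] and [x2], these are known when it is
   |d-1>, and serve as ancillas in state |0> after a shift; when [z] is not
   |d-1>, the garbage computed with them is irrelevant. *)
Lemma pair_from_single z (x1 x2 : 'I_n) s : uniq [:: z, x1, x2 & s] ->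
  single_spec s x1 x2 -> s != [::] -> pair_spec [:: x1, x2 & s] z.
Proof.
move=> /= /and4P[]; rewrite !inE !negb_or.
move=> /and3P[zx1 zx2 zs] /andP[x12 x1s] x2s us [p [r [sp rs cp rp]]] s0.
exists [:: And x1 x2 z, Shift x1, Shift x2 & p], r; split=> /=.
- rewrite !inE !eqxx !orbT [x1 == z]eq_sym zx1 [x2 == z]eq_sym zx2 /=.
  by apply: step_in_sub sp => i is1; rewrite inE is1 orbT.
- by rewrite inE rs orbT.
- have : (0 < size s)%N by rewrite lt0n size_eq0.
  rewrite cp; lia.
move=> x x0; set y1 := bmap _ z _ x; set y := bmap _ x2 _ _.
have y1z : on z y1 = on x1 x && on x2 x by apply: run_And; rewrite // eq_sym.
have y1E i : i != z -> y1 i = x i by apply: bmap_ne.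
have yE i : i != x1 -> i != x2 -> y i = y1 i.
  by move=> i1 i2; rewrite bmap_ne // bmap_ne.
have yx1 : on x1 x -> y x1 = 0.
  by rewrite bmap_ne // /bmap upd_eq y1E 1?eq_sym // => /eqP ->; rewrite ordS_max.
have yx2 : on x2 x -> y x2 = 0.
  rewrite [in y x2]/y {1}/bmap upd_eq bmap_ne 1?eq_sym // y1E 1?eq_sym //.
  by move=> /eqP ->; rewrite ordS_max.
have -> : on z (run p y) = on x1 x && on x2 x.
  by rewrite -y1z /on (run_ne _ sp) ?yE // !inE !negb_or zx1 zx2.
rewrite -andbA; case o1: (on x1 x); case o2: (on x2 x) => //=.
rewrite rp ?yx1 ?yx2 //; apply: eq_in_all => i iis.
have ni k : k \notin s -> i != k by apply: contraNneq => <-.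
by rewrite /on yE ?y1E ?ni.
Qed.

(** Strong induction, two elements at a time: the tail is handled with [x1] and [x2] as ancillas,
    which splits the conjunction of [s] over [z] and [r]; one more [And] merges it into [z'], still
    clean. *)
Lemma single_ladder s z z' : s != [::] -> uniq [:: z, z' & s] -> single_spec s z z'.
Proof.
have [m] := ubnP (size s); elim: m s z z' => // m IHm.
case=> [//|x1 [|x2 [|x3 s]]] z z' ltm _ uzs.
- by exists [::], x1; split=> //= [|x _ _]; rewrite ?inE ?eqxx ?orbT ?andbT.
- move: uzs => /=; rewrite !inE !negb_or => /and4P[_ /andP[z1 z2] _ _].
  exists [:: And x1 x2 z'], z'; split=> //=.
  + by rewrite !inE !eqxx !orbT [x1 == _]eq_sym z1 [x2 == _]eq_sym z2.
  + by rewrite inE eqxx.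
  + by move=> x _ x0; rewrite andbT; apply: run_And; rewrite // eq_sym.
set t := x3 :: s in ltm uzs *; have t0 : t != [::] by [].
have ut : uniq [:: x1, x2 & t] by case/and3P: uzs.
have uz : uniq [:: z, x1, x2 & t].
  move: uzs; rewrite cons_uniq inE negb_or => /andP[/andP[_ zt] _].
  by rewrite cons_uniq zt.
have st : single_spec t x1 x2 by apply: IHm => //; apply: ltnW.
have [p [r [sp rt cp rp]]] := pair_from_single uz st t0.
have [zz' z't] : z != z' /\ z' \notin [:: x1, x2 & t].
  by move: uzs; rewrite cons_uniq inE negb_or => /andP[/andP[-> _] /andP[->]].
have rz' : r != z' by apply: contraNneq z't => <-.
exists (rcons p (And z r z')), z'; split.
- rewrite all_rcons /= zz' rz' !inE !eqxx /= !orbT; move: (rt); rewrite !inE => ->.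
  rewrite !orbT /=; apply: step_in_sub sp => i; rewrite !inE => /orP[->//|->].
  by rewrite !orbT.
- by rewrite inE eqxx.
- by rewrite -cats1 count_cat cp /= !subSS subn0 addn1.
move=> x xz xz'; rewrite -rp // /run foldl_rcons -/(run p x) run_And //.
by rewrite (run_ne _ sp) // inE negb_or eq_sym zz'.
Qed.

Lemma pair_ladder z s : (2 < size s)%N -> uniq (z :: s) -> pair_spec s z.
Proof.
case: s => [|x1 [|x2 [|x3 s]]] // _ us; apply: pair_from_single => //.
by apply: single_ladder => //; case/andP: us.
Qed.

(** [f] is prescribed only where [b] is on; there an initial [Shift] makes [b] a clean ancilla. The
    cost is [8 * (size s - 2)] for the [And] steps plus 4 for the doubly controlled [U] that they
    conjugate. *)
Lemma synth_ladder s b j : (2 < size s)%N -> uniq [:: j, b & s] ->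
  exists f, [/\ indep j f, forall x, on b x -> f x = all_on s x
    & forall U, U \is unitarymx -> \det U = 1 ->
      synthesizable (8 * size s - 12) (ctl f j U)].
Proof.
move=> s2 /andP[js us]; have [p [r [sp rs cp rp]]] := pair_ladder s2 us.
have [bj rj] : b != j /\ r != j.
  by split; apply: contraNneq js => <-; rewrite inE ?rs ?eqxx ?orbT.
have sp' : all (step_in (b :: s)) (Shift b :: p) by rewrite /= inE eqxx.
pose f0 (x : state) := on b x && on r x.
have jf0 : indep j f0 by apply: indepI; apply: on_indep.
exists (f0 \o run (Shift b :: p)); split; first exact: run_indep sp' _ _.
  move=> x /eqP xb; rewrite /= /f0 rp; last by rewrite /bmap upd_eq xb ordS_max.
  apply: eq_in_all => i iis; rewrite /on bmap_ne //.
  by case/andP: us => nbs _; apply: contraNneq nbs => <-.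
move=> U uU dU; have := synth_run sp' js (synth_ctl2 bj rj uU dU).
by apply: synth_leq; rewrite /= cp; lia.
Qed.

Lemma synth_multi_controlled s b j U : (2 < size s)%N -> uniq [:: j, b & s] ->
  U \is unitarymx -> \det U = 1 ->
  synthesizable (16 * size s - 22) (ctl (fun x => all_on (b :: s) x) j U).
Proof.
move=> s2 us uU dU; have [f [jf fE sf]] := synth_ladder s2 us.
have [P [Q [xP xQ ->]]] := SU_comm uU dU.
have uP := X_like_unitary xP; have uQ := X_like_unitary xQ.
(* [synth_ladder] needs determinant 1; rescaling [P] leaves the commutator unchanged. *)
have [c [c0 ucP dcP]] := SU_scale uP.
have bj : b != j.
  by move: us; rewrite /= inE negb_or eq_sym => /andP[/andP[]].
have -> : P * Q * P^-1 * Q^-1 = (c *: P) * Q * (c *: P)^-1 * Q^-1.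
  rewrite invrZ ?unitarymx_isunit ?unitfE // -!scalerAl -!scalerAr -!scalerAl.
  by rewrite scalerA mulfV // scale1r.
have -> : ctl (fun x => all_on (b :: s) x) j
    (c *: P * Q * (c *: P)^-1 * Q^-1) =
    ctl (fun x => f x && on b x) j (c *: P * Q * (c *: P)^-1 * Q^-1).
  by apply: eq_ctl => x /=; case ob: (on b x); rewrite ?andbF ?andbT //= fE.
rewrite -ctl_comm ?unitarymx_isunit //; last exact: on_indep.
have dV : \det (c *: P)^-1 = 1 by rewrite -[_^-1]/(invmx _) det_inv dcP invr1.
apply: (@synth_leq _ _ _ ((8 * size s - 12) + 1 + (8 * size s - 12) + 1)); first lia.
have [xQ' uV] := (X_like_V xQ, unitarymxV ucP).
do !apply: synthM; by [apply: sf | apply: synth_X_like].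
Qed.

End Ladder.

(** * The case of [n - 1] controls and the numerical bound *)

Theorem mainTheorem1 (R : realType) (d n : nat) (hd : (2 <= d)%N)
    (hn : (7 <= n)%N) (U : 'M[R[i]]_d) (hU : U \is unitarymx)
    (hdet : \det U = 1) (last : 'I_n) (hlast : last = n.-1 :> nat) :
  synthesizable (N_SU d n)
    (controlled [set i : 'I_n | (i < n.-1)%N] last U).
Proof.
(* For [d = 3] this reads [112 <= 16 * n], an equality at [n = 7]. *)
have N_ge : (16 * n - 48 <= N_SU d n)%N.
  rewrite /N_SU; case: eqP => [//|d2]; case: eqP => [_|d3]; first lia.
  nia.
case: d hd U hU hdet N_ge => [//|d] hd U hU hdet N_ge.
set A := [set i : 'I_n | _].
have lA : last \notin A by rewrite inE hlast ltnn.
have cA : #|A| = n.-1.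
  have -> : A = ~: [set last].
    apply/setP=> i; rewrite !inE -val_eqE /= hlast; have := ltn_ord i; lia.
  by rewrite cardsC1 card_ord.
have uA := enum_uniq A; have sA : size (enum A) = n.-1 by rewrite -cardE.
rewrite controlledE.
case eA: (enum A) => [|b s] in sA uA; first by rewrite /= in sA; lia.
have uj : uniq [:: last, b & s] by rewrite cons_uniq -eA mem_enum lA eA.
have s2 : (2 < size s)%N by move: sA => /=; lia.
have -> : ctl (fun x => [forall i in A, x i == ord_max]) last U =
    ctl (fun x => all (fun i => on i x) (b :: s)) last U.
  apply: eq_ctl => x; rewrite -eA; apply/forall_inP/allP => h i.
    by rewrite mem_enum => /h.
  by move=> iA; apply: h; rewrite mem_enum.
(* One control plays the role of [b], so [size s = n - 2] and the cost is
   [16 * (n - 2) - 22 = 16 * n - 54]. *)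
apply: synth_leq (synth_multi_controlled _ s2 uj hU hdet) => //.
by apply: leq_trans N_ge; move: sA => /=; lia.
Qed.
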